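(* Let $X_1,X_2,\ldots$ be i.i.d. from $g$, and consider the problems $(\mathcal P)$ and $(\mathcal P_n)$ defined in the context. Suppose that: (1) for every $L\in\mathcal L$ the random variables $\phi_j(X)L(X)$, $j=0,\ldots,l$, are integrable with respect to $g$; (2) $\mathcal L$ is a convex set; (3) there exists $L_0\in\mathcal L$ such that $\mathbb E_g[\phi_j(X)L_0(X)]<\mu_j$ for $j=1,\ldots,m$ and $\mathbb E_g[\phi_j(X)L_0(X)]=\mu_j$ for $j=m+1,\ldots,l$, and moreover $(\mu_{m+1},\ldots,\mu_l)$ is an interior point of $\{(\mathbb E_g[\phi_{m+1}(X)L(X)],\ldots,\mathbb E_g[\phi_l(X)L(X)]):L\in\mathcal L\}\subset\mathbb R^{l-m}$; (4) $val(\mathcal P)$ is finite; (5) for each $j=0,\ldots,l$ the function class $\mathcal F_j:=\{\phi_j(x)L(x):L\in\mathcal L\}$ has an integrable envelope (with respect to $P_g$) and is $P_g$-Glivenko–Cantelli, i.e. $\|P_n-P_g\|_{\mathcal F_j}\overset{\text{a.s.*}}{\to}0$. Then $|val(\mathcal P_n)-val(\mathcal P)|\overset{\text{a.s.*}}{\to}0$ as $n\to\infty$.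
   Context: Setting. $\mathcal X$ is a subset of a Euclidean space, $\phi_0,\ldots,\phi_l:\mathcal X\to\mathbb R$ are known functions, $0\le m\le l$, and $\mu_1,\ldots,\mu_l\in\mathbb R$. One of $\phi_1,\ldots,\phi_l$ is the indicator $I(x\in\mathcal X)$ (total mass constraint). $\mathcal F$ is a class of nonnegative functions (densities whose total mass is prescribed only through the moment constraints) on $\mathcal X$. $g$ is a fixed positive probability density on $\mathcal X$, $X$ has density $g$, $\mathbb E_g$ is expectation under $g$, and $\mathcal L=\{f/g:f\in\mathcal F\}$. Problem $(\mathcal P)$: $\sup_{L\in\mathcal L}\mathbb E_g[\phi_0(X)L(X)]$ subject to $\mathbb E_g[\phi_j(X)L(X)]\le\mu_j$ for $j=1,\ldots,m$ and $\mathbb E_g[\phi_j(X)L(X)]=\mu_j$ for $j=m+1,\ldots,l$. Problem $(\mathcal P_n)$: $\sup_{L\in\mathcal L}\frac1n\sum_{i=1}^n\phi_0(X_i)L(X_i)$ subject to $\frac1n\sum_{i=1}^n\phi_j(X_i)L(X_i)\le\mu_j$ for $j=1,\ldots,m$ and $\frac1n\sum_{i=1}^n\phi_j(X_i)L(X_i)=\mu_j$ for $j=m+1,\ldots,l$. $val(\cdot)$ denotes the optimal value in $[-\infty,\infty]$ (with $\sup\emptyset=-\infty$). If $l=m$, the interior point condition is vacuous. Empirical process notation. $P_g$ is the law of $X$, $P_n=\frac1n\sum_{i=1}^n\delta_{X_i}$, $P_gh=\mathbb E_g[h(X)]$, $P_nh=\frac1n\sum_{i=1}^nh(X_i)$,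 and $\|Q\|_{\mathcal H}=\sup\{|Qh|:h\in\mathcal H\}$ for a signed measure $Q$ and a function class $\mathcal H$. An envelope of $\mathcal H$ is a function $H$ with $\sup_{h\in\mathcal H}|h(x)|\le H(x)$ for all $x$. Outer almost sure convergence. For an arbitrary map $T:\Omega\to[-\infty,\infty]$ on the probability space $(\Omega,\mathcal G,\mathbb P)$, $T^*$ denotes its minimal measurable majorant: $T^*$ is measurable, $T^*\ge T$, and $T^*\le U$ a.s. for every measurable $U$ with $U\ge T$ a.s. For arbitrary maps, $Z_n\overset{\text{a.s.*}}{\to}Z$ means $|Z_n-Z|^*\to0$ almost surely. *)

(* Defs.v *)
From HB Require Import structures.
From mathcomp Require Import all_boot all_order all_algebra finmap.
From mathcomp Require Import all_classical all_reals all_analysis measurable_realfun.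

Set Implicit Arguments.
Unset Strict Implicit.
Unset Printing Implicit Defensive.
Import Order.TTheory GRing.Theory Num.Theory.
Import numFieldNormedType.Exports.
Local Open Scope classical_set_scope.
Local Open Scope ring_scope.

(* [Pg] has density [g] on [D] with respect to the reference measure [lambda];
   since [Pg] is a probability, [g] then integrates to 1 over [D]. *)
Definition has_density (d : measure_display) (T : measurableType d)
    (R : realType) (lambda : {sigma_finite_measure set T -> \bar R})
    (D : set T) (g : T -> R) (Pg : probability T R) : Prop :=
  measurable_fun D g /\
  forall A : set T, measurable A ->
    Pg A = (\int[lambda]_(x in A `&` D) (g x)%:E)%E.

Definition mutually_independent (d d' : measure_display)
    (Omega : measurableType d) (T : measurableType d') (R : realType)
    (P : probability Omega R) (X : nat -> {RV P >-> T}) : Prop :=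
  forall (J : {fset nat}) (A : nat -> set T),
    (forall i, measurable (A i)) ->
    P (\bigcap_(i in [set` J]) (X i @^-1` A i)) =
    (\prod_(i <- J) P (X i @^-1` A i))%E.

Definition iid (d d' : measure_display)
    (Omega : measurableType d) (T : measurableType d') (R : realType)
    (P : probability Omega R) (X : nat -> {RV P >-> T})
    (Pg : probability T R) : Prop :=
  mutually_independent X /\
  forall (i : nat) (A : set T), measurable A -> distribution P (X i) A = Pg A.

(* The variables X_1, X_2, ... are [X 0], [X 1], ...; the value at n = 0 is
   irrelevant for limits. *)
Definition empirical (d d' : measure_display)
    (Omega : measurableType d) (T : measurableType d') (R : realType)
    (P : probability Omega R) (X : nat -> {RV P >-> T})
    (n : nat) (w : Omega) (h : T -> R) : \bar R :=
  (n%:R^-1 * \sum_(i < n) h (X i w))%:E.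

(* Functions on [D] are represented by functions on the whole space; the
   quotients f / g are normalized to 0 off [D], so that algebraic operations
   on them are those of functions on [D]. *)
Definition likelihood_ratios (T : Type) (R : realType) (D : set T)
    (g : T -> R) (F : set (T -> R)) : set (T -> R) :=
  [set (fun x => if x \in D then f x / g x else 0) | f in F].

(* Feasible set and optimal value of the moment problem in which the
   expectation operator is [E]; [mu 0], and [phi j] and [mu j] for l < j,
   are not used. *)
Definition feasible (T : Type) (R : realType) (l m : nat)
    (phi : nat -> T -> R) (mu : nat -> R) (E : (T -> R) -> \bar R)
    (Ls : set (T -> R)) : set (T -> R) :=
  [set L | [/\ Ls L,
    forall j : nat, (1 <= j <= m)%N -> (E (phi j \* L)%R <= (mu j)%:E)%E &
    forall j : nat, (m < j <= l)%N -> E (phi j \* L) = (mu j)%:E]].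

Definition moment_val (T : Type) (R : realType) (l m : nat)
    (phi : nat -> T -> R) (mu : nat -> R) (E : (T -> R) -> \bar R)
    (Ls : set (T -> R)) : \bar R :=
  ereal_sup [set E (phi 0%N \* L) | L in feasible l m phi mu E Ls].

Definition min_measurable_majorant (d : measure_display)
    (Omega : measurableType d) (R : realType) (P : probability Omega R)
    (T Tstar : Omega -> \bar R) : Prop :=
  [/\ measurable_fun [set: Omega] Tstar,
      forall w, (T w <= Tstar w)%E &
      forall U : Omega -> \bar R, measurable_fun [set: Omega] U ->
        {ae P, forall w, (T w <= U w)%E} ->
        {ae P, forall w, (Tstar w <= U w)%E}].

(* The majorants |Z_n - Z|^* are only determined up to null sets, and the
   choice of versions does not affect almost sure convergence. *)
Definition outer_as_cvg (d : measure_display)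
    (Omega : measurableType d) (R : realType) (P : probability Omega R)
    (Z : nat -> Omega -> \bar R) (Zlim : Omega -> \bar R) : Prop :=
  exists S : nat -> Omega -> \bar R,
    (forall n, min_measurable_majorant P
                 (fun w => `|Z n w - Zlim w|%E) (S n)) /\
    {ae P, forall w, S n w @[n --> \oo] --> (0 : \bar R)}.

Definition empirical_discrepancy (d d' : measure_display)
    (Omega : measurableType d) (T : measurableType d') (R : realType)
    (P : probability Omega R) (X : nat -> {RV P >-> T})
    (Pg : probability T R) (H : set (T -> R)) (n : nat) (w : Omega) : \bar R :=
  ereal_sup [set `|empirical X n w h - 'E_Pg[h]|%E | h in H].

Definition glivenko_cantelli (d d' : measure_display)
    (Omega : measurableType d) (T : measurableType d') (R : realType)
    (P : probability Omega R) (X : nat -> {RV P >-> T})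
    (Pg : probability T R) (H : set (T -> R)) : Prop :=
  outer_as_cvg P (empirical_discrepancy X Pg H) (cst (0 : \bar R)).

Definition has_integrable_envelope (d : measure_display)
    (T : measurableType d) (R : realType) (Pg : probability T R)
    (D : set T) (H : set (T -> R)) : Prop :=
  exists env : T -> R,
    (forall h, H h -> forall x, D x -> `|h x| <= env x) /\
    Pg.-integrable D (EFin \o env).

(* The vector (E[phi_{m+1} L], ..., E[phi_l L]). *)
Definition eq_moments (d : measure_display) (T : measurableType d)
    (R : realType) (Pg : probability T R) (l m : nat) (phi : nat -> T -> R)
    (L : T -> R) : 'rV[R]_(l - m) :=
  \row_(i < l - m) fine 'E_Pg[phi (m + i.+1)%N \* L]%E.

(* Main.v *)
Require Import Defs.
From HB Require Import structures.
From mathcomp Require Import all_boot all_order all_algebra finmap.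
From mathcomp Require Import all_classical all_reals all_analysis measurable_realfun.
From mathcomp Require Import ring lra zify.

Set Implicit Arguments.
Unset Strict Implicit.
Unset Printing Implicit Defensive.
Import Order.TTheory GRing.Theory Num.Theory.
Import numFieldNormedType.Exports.
Local Open Scope classical_set_scope.
Local Open Scope ring_scope.

(* A convex set that meets every open orthant of the space of equality moments
   contains a point where all of them vanish, which is proved by induction on
   the dimension.  Slater's condition and the interior point condition provide,
   for each orthant, a likelihood ratio that satisfies the inequality
   constraints with slack and displaces the equality moments into that orthant.
   These witnesses survive a small perturbation of all moments,
   hence serve both problems as soon as the empirical moments are uniformly
   within eps of the true ones: any L feasible for one problem is repaired into
   one feasible for the other by giving the witnesses weight O(eps), which
   changes the objective by O(eps) because it is bounded through its envelope.
   The optimal values thus differ by at most a constant times the sum of the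
   measurable majorants given by the Glivenko-Cantelli property. *)

(** * Convexity and the repair of almost feasible points *)

Definition affine_on (R : realType) (V : lmodType R) (K : set V) (f : V -> R) :=
  forall x y t, K x -> K y -> 0 <= t <= 1 ->
    f (t *: x + (1 - t) *: y) = t * f x + (1 - t) * f y.

Lemma convex_setP (R : realType) (V : lmodType R) (K : set V) :
  convex_set K <-> forall x y t, K x -> K y -> 0 <= t <= 1 ->
    K (t *: x + (1 - t) *: y).
Proof.
split=> [cK x y t Kx Ky /andP[t0 t1]|cK x y t /set_mem Kx /set_mem Ky].
  have := cK x y (Itv01 t0 t1) (mem_set Kx) (mem_set Ky).
  by rewrite inE.
by apply/mem_set/cK => //; rewrite ge0 le1.
Qed.

(** Passing to the slice [f n = 0] removes one function. The slice inherits the orthant condition: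
    two points that agree with [s] below [n] but give [f n] opposite signs span a segment, which
    crosses the slice inside the orthant. *)
Lemma convex_common_zero (R : realType) (V : lmodType R) (K : set V)
    (n : nat) (f : nat -> V -> R) :
  convex_set K -> (forall i, (i < n)%N -> affine_on K (f i)) ->
  (forall s : nat -> bool, exists2 x, K x &
     forall i, (i < n)%N -> 0 < (-1) ^+ s i * f i x) ->
  exists2 x, K x & forall i, (i < n)%N -> f i x = 0.
Proof.
elim: n K => [|n IHn] K cK fK orth.
  by have [x Kx _] := orth xpredT; exists x.
have /convex_setP cKE := cK.
pose K0 := K `&` [set x | f n x = 0].
have [||s|x [Kx fn0] fx] := IHn K0.
- apply/convex_setP => x y t [Kx fx] [Ky fy] t01; split; first exact: cKE.
  by rewrite /= fK// fx fy !mulr0 addr0.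
- by move=> i /ltnW ltin x y t [Kx _] [Ky _]; exact: fK.
- have [x Kx xP] := orth (fun i => (i != n) && s i).
  have [y Ky yP] := orth (fun i => (i == n) || s i).
  have fx : 0 < f n x by have := xP n (ltnSn n); rewrite eqxx /= mul1r.
  have fy : f n y < 0.
    by have := yP n (ltnSn n); rewrite eqxx /= expr1 mulN1r oppr_gt0.
  have d0 : 0 < f n x - f n y by lra.
  (* The weight at which [f n] vanishes on the segment. *)
  pose t := - f n y / (f n x - f n y).
  have t01 : 0 <= t <= 1.
    by rewrite divr_ge0 ?ler_pdivrMr//; lra.
  exists (t *: x + (1 - t) *: y).
    split; first exact: cKE.
    by rewrite /= fK// /t; field; rewrite gt_eqF.
  move=> i lin; have := xP i (ltnW lin); have := yP i (ltnW lin).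
  rewrite (ltn_eqF lin)/= => yi xi.
  rewrite fK ?ltnS ?(ltnW lin)// mulrDr !(mulrCA _ t) !(mulrCA _ (1 - t)).
  have : 0 < t by rewrite divr_gt0//; lra.
  have : 0 <= 1 - t by lra.
  nra.
- exists x => // i; rewrite ltnS leq_eqVlt => /predU1P[->//|]; exact: fx.
Qed.

(* A sign pattern [s] encodes an orthant of the space of the equality moments
   [B j], [m < j <= l], centred at the target [mu]. *)
Definition corners (R : realType) (V : lmodType R) (C : set V) (l m : nat)
    (B : nat -> V -> R) (mu : nat -> R) (kappa : R) :=
  forall s : nat -> bool, exists2 x, C x &
    (forall j, (1 <= j <= m)%N -> B j x <= mu j - kappa) /\
    (forall j, (m < j <= l)%N -> kappa <= (-1) ^+ s j * (B j x - mu j)).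

(* Mixing the almost feasible [L] with weight [2 eps / kappa] of the corner
   points gives points which satisfy the inequality constraints and whose
   equality moments surround the target; [convex_common_zero] then hits it. *)
Lemma feasible_repair (R : realType) (V : lmodType R) (C : set V)
    (l m : nat) (B : nat -> V -> R) (mu : nat -> R) (kappa eps M : R) (L : V) :
  convex_set C -> (m <= l)%N -> (forall j, (j <= l)%N -> affine_on C (B j)) ->
  (forall x, C x -> `|B 0%N x| <= M) ->
  corners C l m B mu kappa ->
  0 < eps -> 2 * eps <= kappa ->
  C L -> (forall j, (1 <= j <= m)%N -> B j L <= mu j + eps) ->
  (forall j, (m < j <= l)%N -> `|B j L - mu j| <= eps) ->
  exists x, [/\ C x, (forall j, (1 <= j <= m)%N -> B j x <= mu j),
    (forall j, (m < j <= l)%N -> B j x = mu j) &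
    B 0%N L - 4 * M / kappa * eps <= B 0%N x].
Proof.
move=> cC ml aB BM corner eps0 epsk CL Lle Leq.
have cCE := (convex_setP _).1 cC.
pose w := 4 * M / kappa * eps.
(* With the inequalities and the loss [w] built into [K], only the equalities remain, as common
   zeros of the [f i]. *)
pose K := C `&` [set x | (forall j, (1 <= j <= m)%N -> B j x <= mu j) /\
                         B 0%N L - w <= B 0%N x].
have k0 : 0 < kappa by lra.
have cK : convex_set K.
  apply/convex_setP => x y t [Cx [xle x0]] [Cy [yle y0]] t01.
  split; first exact: cCE.
  split=> [j jm|]; last by rewrite aB//; nra.
  have /andP[j0 jm'] := jm.
  rewrite aB ?(leq_trans jm')//; have := xle _ jm; have := yle _ jm; nra.
pose f i x := B (m + i.+1)%N x - mu (m + i.+1)%N.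
have [|s|x [Cx [xle x0]] fx] := @convex_common_zero R V K (l - m) f cK.
(* The [f i] number the equality constraints from 0, so sign patterns are shifted by [m.+1] in the
   second goal. *)
- move=> i il x y t [Cx _] [Cy _] t01.
  by rewrite /f aB//; [lra | lia].
- have [y Cy [yle yeq]] := corner (fun j => s (j - m.+1)%N).
  (* The displacement [t * kappa = 2 * eps] beats the error [(1 - t) * eps], so each equality moment
     lands strictly on the prescribed side. *)
  pose t := 2 * eps / kappa.
  have t01 : 0 <= t <= 1.
    by rewrite divr_ge0 ?ler_pdivrMr ?mul1r//; lra.
  have tk : t * kappa = 2 * eps by rewrite /t; field; rewrite gt_eqF.
  exists (t *: y + (1 - t) *: L).
    split; first exact: cCE.
    split=> [j jm|].
      have /andP[j0 jm'] := jm.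
      rewrite aB ?(leq_trans jm')//; have := Lle _ jm; have := yle _ jm.
      move=> h1 h2.
      have : t * B j y <= t * (mu j - kappa) by apply: ler_wpM2l => //; lra.
      have : (1 - t) * B j L <= (1 - t) * (mu j + eps).
        by apply: ler_wpM2l => //; lra.
      have : t * eps >= 0 by apply: mulr_ge0; lra.
      lra.
    rewrite aB//.
    have := BM _ Cy; have := BM _ CL; rewrite !ler_norml => /andP[_ h1] /andP[h2 _].
    (* Both objective values lie between [- M] and [M], so mixing costs at most [t * (2 * M)]. *)
    have -> : w = t * (2 * M) by rewrite /w /t; field; rewrite gt_eqF.
    have : t * (- M) <= t * B 0%N y by apply: ler_wpM2l => //; lra.
    have : t * B 0%N L <= t * M by apply: ler_wpM2l => //; lra.
    lra.
  move=> i il; have jl : (m < m + i.+1 <= l)%N by lia.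
  rewrite /f aB//; last by case/andP: jl.
  have := yeq _ jl; have := Leq _ jl.
  rewrite ler_norml addnS subSS addKn -addnS => /andP[h1 h2] h3.
  set e := (-1) ^+ s i in h3 *; set b := B _ L in h1 h2 *.
  have h4 : - eps <= e * (b - mu (m + i.+1)%N).
    by rewrite /e; case: (s i); rewrite ?expr1 ?expr0; lra.
  have : t * kappa <= t * (e * (B (m + i.+1)%N y - mu (m + i.+1)%N)).
    by apply: ler_wpM2l => //; lra.
  have : (1 - t) * (- eps) <= (1 - t) * (e * (b - mu (m + i.+1)%N)).
    by apply: ler_wpM2l => //; lra.
  have : t * eps >= 0 by apply: mulr_ge0; lra.
  lra.
- exists x; split=> // j /andP[mj jl].
  have := fx (j - m.+1)%N; rewrite /f addnS -addSn subnKC// => fj.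
  by apply/eqP; rewrite -subr_eq0; apply/eqP/fj; lia.
Qed.

(** * Measurable hulls and minimal majorants *)

(** A countable intersection of measurable supersets attains the infimum [c] of their probabilities.
    Cutting it with another such superset cannot go below [c], so what is cut off is null. *)
Lemma measurable_hull (d : measure_display) (T : measurableType d)
    (R : realType) (P : probability T R) (A : set T) :
  exists H : set T, [/\ measurable H, A `<=` H &
    forall B, measurable B -> A `<=` B -> P (H `\` B) = 0%E].
Proof.
pose c := ereal_inf [set P B | B in [set B | measurable B /\ A `<=` B]].
have c_fin : c \is a fin_num.
  rewrite fin_numElt; apply/andP; split.
    apply: (@lt_le_trans _ _ 0%E) => //; apply: le_ereal_inf_tmp => _ [B _ <-].
    exact: measure_ge0.
  apply: (@le_lt_trans _ _ 1%E); last by rewrite ltry.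
  apply: ge_ereal_inf; exists (P setT); last by rewrite probability_setT.
  by exists setT.
have /choice[B BP] : forall n : nat, exists B,
    [/\ measurable B, A `<=` B & (P B < c + (n.+1%:R^-1)%:E)%E].
  move=> n; have [|_ [B [mB AB] <-] ltB] := @lb_ereal_inf_adherent R
      [set P B | B in [set B | measurable B /\ A `<=` B]] n.+1%:R^-1 _ c_fin.
    by rewrite invr_gt0.
  by exists B.
have mH : measurable (\bigcap_n B n).
  by apply: bigcap_measurable => // n _; have [] := BP n.
exists (\bigcap_n B n); split=> // [x Ax n _|E mE AE].
  by have [_ + _] := BP n; exact.
have PHc : (P (\bigcap_n B n) <= c)%E.
  apply/lee_addgt0Pr => e e0.
  have [n _ /(_ _ (leqnn n)) ne] := near_infty_natSinv_lt (PosNum e0).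
  have [mB _ /ltW PB] := BP n.
  apply: le_trans (le_trans PB _).
    by apply: le_measure; rewrite ?inE//; exact: bigcap_inf.
  by rewrite leeD2l// lee_fin ltW.
have cHE : (c <= P (\bigcap_n B n `&` E))%E.
  apply: ereal_inf_lbound; exists (\bigcap_n B n `&` E) => //; split.
    exact: measurableI.
  by move=> x Ax; split; [move=> n _; have [_ + _] := BP n; exact|exact: AE].
have Pfin : (P (\bigcap_n B n) < +oo)%E.
  by apply: le_lt_trans PHc _; rewrite ltey_eq c_fin.
rewrite (measureD (mu := P) mH mE Pfin).
apply/eqP; rewrite eq_le; apply/andP; split; last first.
  by rewrite -(measureD (mu := P) mH mE Pfin).
rewrite leeBlDr ?add0e; first exact: le_trans PHc cHE.
rewrite ge0_fin_numE//; apply: le_lt_trans Pfin.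
by apply: le_measure; rewrite ?inE//; exact: measurableI.
Qed.

Lemma lte_rat_between (R : realType) (x y : \bar R) :
  (x < y)%E -> exists q : rat, (x < (ratr q)%:E)%E && ((ratr q)%:E < y)%E.
Proof.
have rat_lt (a b : R) : a < b -> exists q : rat, a < ratr q < b.
  by move=> /rat_in_itvoo[q]; rewrite in_itv/=; exists q.
case: x y => [x||] [y||] //.
- by rewrite lte_fin => /rat_lt[q]; exists q; rewrite !lte_fin.
- have /rat_lt[q /andP[xq _]] : x < x + 1 by rewrite ltrDl.
  by exists q; rewrite lte_fin xq ltry.
- have /rat_lt[q /andP[_ qy]] : y - 1 < y by rewrite ltrBlDr ltrDl.
  by exists q; rewrite lte_fin qy ltNyr.
- by exists 0; rewrite ltNyr ltry.
Qed.

(* The majorant is the supremum of the rationals [q] weighted by measurable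
   hulls of the level sets [f > q]. *)
Lemma ex_min_measurable_majorant (d : measure_display) (T : measurableType d)
    (R : realType) (P : probability T R) (f : T -> \bar R) :
  exists g, min_measurable_majorant P f g.
Proof.
have /choice[H HP] : forall q : rat, exists H : set T, [/\ measurable H,
    [set x | ((ratr q)%:E < f x)%E] `<=` H &
    forall B, measurable B -> [set x | ((ratr q)%:E < f x)%E] `<=` B ->
    P (H `\` B) = 0%E].
  by move=> q; exact: measurable_hull.
(* Enumerating the rationals makes the supremum countable, hence measurable; the default [-oo] is
   neutral for it. *)
pose h (n : nat) x : \bar R := if @choice.unpickle rat n is Some q
  then (if x \in H q then (ratr q)%:E else -oo%E) else -oo%E.
have mh n : measurable_fun setT (h n).
  rewrite /h; case: choice.unpickle => [q|]; last exact: measurable_cst.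
  have [mH _ _] := HP q.
  apply: measurable_fun_ifT; [|exact: measurable_cst|exact: measurable_cst].
  apply: (measurable_fun_bool true); rewrite setTI.
  by rewrite (_ : _ @^-1` _ = H q)//; apply/seteqP; split=> x /=; [exact: set_mem|exact: mem_set].
exists (fun x => esups (h ^~ x) 0%N); split.
- exact: measurable_fun_esups.
- move=> x; rewrite leNgt; apply/negP => lt_g.
  have [q /andP[gq qf]] : exists q : rat,
      (esups (h ^~ x) 0%N < (ratr q)%:E)%E && ((ratr q)%:E < f x)%E.
    exact: lte_rat_between.
  have [_ /(_ _ qf) Hx _] := HP q.
  move: gq; rewrite ltNge => /negP; apply; apply: ereal_sup_ubound => /=.
  by exists (choice.pickle q) => //; rewrite /h choice.pickleK mem_set.
- move=> U mU fU.
  have : \forall x \ae P, forall n, (h n x <= U x)%E.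
    apply: ae_foralln => n; rewrite /h; case: choice.unpickle => [q|];
      last by apply: nearW => x; rewrite leNye.
    have [mH AH HE] := HP q.
    case: fU => N [mN PN fUN].
    (* [U] dominates [f] only off the null set [N]; adding [N] gives a true superset of the level
       set, as the hull property requires. *)
    have mB : measurable ([set x | ((ratr q)%:E < U x)%E] `|` N).
      apply: measurableU => //.
      by rewrite -[X in measurable X]setTI; exact: emeasurable_fun_o_infty.
    exists (N `|` (H q `\` ([set x | ((ratr q)%:E < U x)%E] `|` N))); split.
    + by apply: measurableU => //; exact: measurableD.
    + rewrite measureU0//; [exact: measurableD|apply: HE => // x /= qf].
      have [Nx|Nx] := pselect (N x); [by right|left].
      apply: lt_le_trans qf _; apply: contrapT => nfU; apply: Nx; exact: fUN.
    + move=> x /=; case: ifPn => [Hx qU|_]; last by rewrite leNye.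
      have [Nx|Nx] := pselect (N x); [by left|right].
      split; first exact/set_mem.
      by case=> // /ltW.
  apply: filterS => x hU; apply: ge_ereal_sup => _ [n _ <-]; exact: hU.
Qed.

(** * Stability and existence of corner points *)

Lemma corners_perturb (R : realType) (V : lmodType R) (C : set V) (l m : nat)
    (A B : nat -> V -> R) (mu : nat -> R) (kappa eps : R) :
  (m <= l)%N -> corners C l m A mu kappa ->
  (forall j x, (j <= l)%N -> C x -> `|A j x - B j x| <= eps) ->
  corners C l m B mu (kappa - eps).
Proof.
move=> ml cA AB s; have [x Cx [xle xeq]] := cA s.
exists x => //; split=> j /[dup] jP /andP[j1 j2].
  have := AB j x (leq_trans j2 ml) Cx; have := xle _ jP.
  by rewrite ler_norml => ? /andP[]; lra.
have := AB j x j2 Cx; have := xeq _ jP.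
by rewrite ler_norml => + /andP[]; case: (s j); rewrite ?expr1 ?expr0; lra.
Qed.

Lemma finite_lower_bound (R : realType) (n : nat) (f : nat -> R) :
  (forall j, (j < n)%N -> 0 < f j) ->
  exists2 e, 0 < e & forall j, (j < n)%N -> e <= f j.
Proof.
elim: n => [|n IHn] f0; first by exists 1.
have [j jn|e e0 ef] := IHn; first by apply: f0; exact: ltnW.
exists (Num.min e (f n)); first by rewrite lt_min e0 f0.
move=> j; rewrite ltnS leq_eqVlt ge_min => /predU1P[->|/ef->//].
by rewrite lexx orbT.
Qed.

(* Giving the displaced points a small weight against the Slater point [L0]
   keeps part of its slack. *)
Lemma slater_corners (R : realType) (V : lmodType R) (C : set V) (l m : nat)
    (B : nat -> V -> R) (mu M : nat -> R) (r : R) (L0 : V) :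
  convex_set C -> (m <= l)%N -> (forall j, (j <= l)%N -> affine_on C (B j)) ->
  (forall j x, (j <= l)%N -> C x -> `|B j x| <= M j) ->
  C L0 -> (forall j, (1 <= j <= m)%N -> B j L0 < mu j) ->
  (forall j, (m < j <= l)%N -> B j L0 = mu j) ->
  0 < r ->
  (forall s : nat -> bool, exists2 x, C x &
     forall j, (m < j <= l)%N -> B j x = mu j + (-1) ^+ s j * r) ->
  exists2 kappa, 0 < kappa & corners C l m B mu kappa.
Proof.
move=> cC ml aB BM CL0 L0le L0eq r0 ball.
have cCE := (convex_setP _).1 cC.
pose sl j := mu j - B j L0.
(* Mixing a point of [C] into [L0] with weight [t] raises [B j] by at most [t * De j]. *)
pose De j := M j + `|mu j| + sl j.
have sDe j : (1 <= j <= m)%N -> 0 < sl j /\ 0 < De j.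
  move=> /[dup] jP /andP[j1 j2]; have s0 : 0 < sl j by rewrite subr_gt0 L0le.
  split=> //; rewrite ltr_wpDl// addr_ge0//.
  exact: le_trans (BM j _ (leq_trans j2 ml) CL0).
(* The first bound is for the slack to be kept, the second for the weight, which may consume half of
   the slack; index 0 is no constraint and gets the filler 1. *)
pose f j := if (1 <= j)%N then Num.min (sl j / 2) (sl j / (2 * De j)) else 1.
have [j|e e0 ef] := @finite_lower_bound R m.+1 f.
  rewrite ltnS /f; case: ifP => // j1 jm.
  have /sDe[s0 D0] : (1 <= j <= m)%N by rewrite j1.
  by rewrite lt_min !divr_gt0// mulr_gt0.
pose t := Num.min e 1.
have t0 : 0 < t by rewrite lt_min e0 ltr01.
have t1 : t <= 1 by rewrite ge_min lexx orbT.
have te : t <= e by rewrite ge_min lexx.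
exists (Num.min e (t * r)); first by rewrite lt_min e0 mulr_gt0.
move=> s; have [x Cx xeq] := ball s.
have t01 : 0 <= t <= 1 by rewrite (ltW t0).
exists (t *: x + (1 - t) *: L0); first exact: cCE.
split=> j /[dup] jP /andP[j1 j2].
  rewrite aB ?(leq_trans j2 ml)//; have [s0 D0] := sDe _ jP.
  have := ef _ j2; rewrite /f j1 le_min => /andP[es eD].
  have {}eD : t * De j <= sl j / 2.
    apply: le_trans (_ : sl j / (2 * De j) * De j <= _).
      by rewrite ler_pM2r// (le_trans te).
    by rewrite le_eqVlt; apply/orP; left; apply/eqP; field; rewrite gt_eqF.
  have emin : Num.min e (t * r) <= sl j / 2.
    by rewrite (le_trans _ es)// ge_min lexx.
  have : t * (B j x - mu j) <= t * (M j + `|mu j|).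
    rewrite ler_wpM2l ?(ltW t0)//.
    have := BM j x (leq_trans j2 ml) Cx; have := ler_norm (- mu j); rewrite normrN.
    by have := ler_norm (B j x); lra.
  by move: eD emin; rewrite /De /sl; lra.
rewrite aB// xeq// L0eq//.
have -> : t * (mu j + (-1) ^+ s j * r) + (1 - t) * mu j - mu j =
  (-1) ^+ s j * (t * r) by ring.
by rewrite signrMK ge_min lexx orbT.
Qed.

(** * Comparison of optimal values *)

Definition moment (T : Type) (R : realType) (phi : nat -> T -> R)
    (E : (T -> R) -> \bar R) (j : nat) (L : T -> R) : R :=
  fine (E (phi j \* L)).

(** A point feasible for [E] violates the constraints for [E'] by at most [eps], so it is repaired
    under [E']. In the constant, 1 pays for reading the objective under [E'], the rest for the
    repair. *)
Lemma moment_val_le (T : Type) (R : realType) (l m : nat)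
    (phi : nat -> T -> R) (mu : nat -> R) (E E' : (T -> R) -> \bar R)
    (Ls : set (T -> R)) (kappa eps M : R) :
  convex_set Ls -> (m <= l)%N ->
  (forall j L, (j <= l)%N -> Ls L -> E (phi j \* L) \is a fin_num) ->
  (forall j L, (j <= l)%N -> Ls L -> E' (phi j \* L) \is a fin_num) ->
  (forall j, (j <= l)%N -> affine_on Ls (moment phi E' j)) ->
  (forall L, Ls L -> `|moment phi E' 0 L| <= M) ->
  corners Ls l m (moment phi E') mu kappa ->
  0 < eps -> 2 * eps <= kappa ->
  (forall j L, (j <= l)%N -> Ls L ->
     `|moment phi E j L - moment phi E' j L| <= eps) ->
  (moment_val l m phi mu E Ls <=
   moment_val l m phi mu E' Ls + ((1 + 4 * M / kappa) * eps)%:E)%E.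
Proof.
move=> cL ml finE finE' aE' E'M E'c eps0 epsk EE'.
have mE j L : (j <= l)%N -> Ls L -> E (phi j \* L) = (moment phi E j L)%:E.
  by move=> jl LL; rewrite fineK// finE.
have mE' j L : (j <= l)%N -> Ls L -> E' (phi j \* L) = (moment phi E' j L)%:E.
  by move=> jl LL; rewrite fineK// finE'.
apply: ge_ereal_sup => _ [L [LL Lle Leq] <-].
have [||x [Lx xle xeq x0]] :=
  @feasible_repair _ _ Ls l m (moment phi E') mu kappa eps M L cL ml aE' E'M
    E'c eps0 epsk LL.
- move=> j /[dup] jP /andP[_ /leq_trans/(_ ml) jl].
  have := Lle _ jP; rewrite mE// lee_fin.
  by have := EE' j L jl LL; rewrite ler_norml => /andP[]; lra.
- move=> j /[dup] jP /andP[_ jl]; have := Leq _ jP; rewrite mE// => -[<-].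
  by rewrite distrC; exact: EE'.
rewrite mE//; apply: (@le_trans _ _ ((moment phi E' 0 x)%:E +
    ((1 + 4 * M / kappa) * eps)%:E)%E).
  rewrite -EFinD lee_fin; have := EE' 0%N L isT LL.
  by rewrite ler_norml => /andP[_]; lra.
rewrite leeD2r// -mE'//; apply: ereal_sup_ubound; exists x => //.
split=> // j /[dup] jP /andP[_ jl].
  by rewrite mE' ?(leq_trans jl)// lee_fin xle.
by rewrite mE' // xeq.
Qed.

(** [moment_val_le] is used in both directions: corners for [E] are corners for [E'] with margin
    [kappa / 2], and [M + kappa] bounds both objectives. *)
Lemma moment_val_dist (T : Type) (R : realType) (l m : nat)
    (phi : nat -> T -> R) (mu : nat -> R) (E E' : (T -> R) -> \bar R)
    (Ls : set (T -> R)) (kappa eps M : R) :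
  convex_set Ls -> (m <= l)%N ->
  (forall j L, (j <= l)%N -> Ls L -> E (phi j \* L) \is a fin_num) ->
  (forall j L, (j <= l)%N -> Ls L -> E' (phi j \* L) \is a fin_num) ->
  (forall j, (j <= l)%N -> affine_on Ls (moment phi E j)) ->
  (forall j, (j <= l)%N -> affine_on Ls (moment phi E' j)) ->
  (forall L, Ls L -> `|moment phi E 0 L| <= M) ->
  corners Ls l m (moment phi E) mu kappa ->
  moment_val l m phi mu E Ls \is a fin_num ->
  0 < eps -> 4 * eps <= kappa ->
  (forall j L, (j <= l)%N -> Ls L ->
     `|moment phi E' j L - moment phi E j L| <= eps) ->
  (`|moment_val l m phi mu E' Ls - moment_val l m phi mu E Ls| <=
   ((1 + 4 * (M + kappa) / (kappa / 2)) * eps)%:E)%E.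
Proof.
move=> cL ml finE finE' aE aE' EM Ec vfin eps0 epsk EE'.
have E'E j L : (j <= l)%N -> Ls L ->
    `|moment phi E j L - moment phi E' j L| <= eps.
  by move=> jl LL; rewrite distrC EE'.
have kE : kappa / 2 = kappa - kappa / 2 by field.
have Ek : corners Ls l m (moment phi E) mu (kappa / 2).
  rewrite kE; apply: corners_perturb Ec _ => // j L _ _.
  by rewrite subrr normr0; lra.
have E'k : corners Ls l m (moment phi E') mu (kappa / 2).
  rewrite kE; apply: corners_perturb Ec _ => // j L jl LL.
  by apply: le_trans (E'E _ _ jl LL) _; lra.
have E'M L : Ls L -> `|moment phi E' 0 L| <= M + kappa.
  move=> LL; have := EM _ LL; have := EE' 0%N L isT LL; rewrite !ler_norml.
  by move=> /andP[? ?] /andP[? ?]; apply/andP; split; lra.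
have EM' L : Ls L -> `|moment phi E 0 L| <= M + kappa.
  by move=> /EM h; apply: le_trans h _; lra.
have epsk2 : 2 * eps <= kappa / 2 by lra.
have le1 := moment_val_le cL ml finE finE' aE' E'M E'k eps0 epsk2 E'E.
have le2 := moment_val_le cL ml finE' finE aE EM' Ek eps0 epsk2 EE'.
move: vfin le1 le2.
case: (moment_val l m phi mu E Ls) => [v||] // _.
(* An infinite value for [E'] contradicts one of the two inequalities. *)
case: (moment_val l m phi mu E' Ls) => [v'||] //.
rewrite -EFinB -!EFinD abse_EFin !lee_fin ler_norml => h1 h2.
by apply/andP; split; lra.
Qed.

(** * Moments under the true and the empirical law *)

Lemma likelihood_ratios_out (T : Type) (R : realType) (D : set T)
    (g : T -> R) (F : set (T -> R)) (L : T -> R) (x : T) :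
  likelihood_ratios D g F L -> ~ D x -> L x = 0.
Proof. by move=> [f _ <-] nDx; rewrite memNset. Qed.

Lemma integrable_out (d : measure_display) (T : measurableType d)
    (R : realType) (P : probability T R) (D : set T) (h : T -> R) :
  measurable D -> (forall x, ~ D x -> h x = 0) ->
  P.-integrable D (EFin \o h) -> P.-integrable setT (EFin \o h).
Proof.
move=> mD hD /(integrable_mkcond _ mD); congr (P.-integrable _ _).
by apply/funext => x; rewrite patchE; case: ifPn => //= /negP xD; rewrite hD// => /mem_set.
Qed.

Lemma affine_expectation (d : measure_display) (T : measurableType d)
    (R : realType) (P : probability T R) (phi : nat -> T -> R) (j : nat)
    (Ls : set (T -> R)) :
  (forall L, Ls L -> P.-integrable setT (EFin \o (phi j \* L))) ->
  affine_on Ls (moment phi (fun h => 'E_P[h])%E j).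
Proof.
move=> iL x y t Lx Ly _; rewrite /moment.
have Lf L : Ls L -> (phi j \* L) \in Lfun P 1.
  by move=> /iL; apply Lfun1_integrable.
have -> : phi j \* (t *: x + (1 - t) *: y) =
    (t \o* (phi j \* x)) \+ ((1 - t) \o* (phi j \* y)).
  apply/funext => z.
  change (phi j z * (t * x z + (1 - t) * y z) =
    phi j z * x z * t + phi j z * y z * (1 - t)); ring.
have LZ L a : Ls L -> (a \o* (phi j \* L)) \in Lfun P 1.
  move=> LL; apply/Lfun1_integrable.
  have := integrableZl measurableT a (iL _ LL); congr (P.-integrable _ _).
  by apply/funext => z /=; rewrite -EFinM mulrC.
rewrite expectationD ?LZ// !expectationZl ?Lf//.
rewrite fineD ?fin_numM ?expectation_fin_num ?Lf//.
by rewrite !fineM ?expectation_fin_num ?Lf.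
Qed.

Lemma affine_empirical (d d' : measure_display)
    (Omega : measurableType d) (T : measurableType d') (R : realType)
    (P : probability Omega R) (X : nat -> {RV P >-> T}) (n : nat) (w : Omega)
    (phi : nat -> T -> R) (j : nat) (Ls : set (T -> R)) :
  affine_on Ls (moment phi (empirical X n w) j).
Proof.
move=> x y t _ _ _; rewrite /moment /empirical /=.
rewrite mulrCA (mulrCA (1 - t)) -mulrDr; congr (_ * _).
rewrite !mulr_sumr -big_split; apply: eq_bigr => i _ /=.
set z := X i w.
change (phi j z * (t * x z + (1 - t) * y z) =
  t * (phi j z * x z) + (1 - t) * (phi j z * y z)); ring.
Qed.

(** The integral of the envelope over [D] serves as [M], because members of [H] vanish off [D]. *)
Lemma expectation_envelope (d : measure_display) (T : measurableType d)
    (R : realType) (P : probability T R) (D : set T) (H : set (T -> R)) :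
  measurable D -> (forall h x, H h -> ~ D x -> h x = 0) ->
  (forall h, H h -> P.-integrable setT (EFin \o h)) ->
  has_integrable_envelope P D H ->
  exists M, forall h, H h -> `|fine ('E_P[h])%E| <= M.
Proof.
move=> mD HD iH [env [Henv ienv]].
exists (fine (\int[P]_(x in D) (env x)%:E)%E) => h Hh.
have fE : (\int[P]_(x in D) (env x)%:E)%E \is a fin_num by exact: integrable_fin_num.
have fh : 'E_P[h]%E \is a fin_num.
  by apply: expectation_fin_num; apply/Lfun1_integrable/iH.
rewrite -lee_fin -abse_EFin !fineK//.
have -> : ('E_P[h] = \int[P]_(x in D) (h x)%:E)%E.
  rewrite unlock [RHS]integral_mkcond; apply: eq_integral => x _.
  by rewrite patchE; case: ifPn => //= /negP xD; rewrite (HD _ _ Hh)// => /mem_set.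
have mh : measurable_fun D (EFin \o h).
  by apply: measurable_funTS; case/integrableP: (iH _ Hh).
apply: le_trans (le_abse_integral _ mD mh) _.
apply: ge0_le_integral => //.
- exact: measurableT_comp.
- by case/integrableP: ienv.
- by move=> x Dx; rewrite /= lee_fin; exact: Henv.
Qed.

(** Balls of row vectors are entrywise, so shifting every coordinate by half the radius, with
    arbitrary signs, stays inside. *)
Lemma interior_orthants (d : measure_display) (T : measurableType d)
    (R : realType) (P : probability T R) (l m : nat) (phi : nat -> T -> R)
    (mu : nat -> R) (Ls : set (T -> R)) :
  interior [set eq_moments P l m phi L | L in Ls]
    (\row_(i < l - m) mu (m + i.+1)%N) ->
  exists2 r, 0 < r & forall s : nat -> bool, exists2 L, Ls L &
    forall j, (m < j <= l)%N ->
      moment phi (fun h => 'E_P[h])%E j L = mu j + (-1) ^+ s j * r.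
Proof.
move=> /nbhs_ballP[e /= e0 eS]; exists (e / 2); first by rewrite divr_gt0.
move=> s; have [|L LL LE] :=
  eS (\row_(i < l - m) (mu (m + i.+1)%N + (-1) ^+ s (m + i.+1)%N * (e / 2))).
  split=> // i j; rewrite !mxE.
  rewrite /ball/= opprD addNKr normrN normrM normrX normrN1 expr1n mul1r.
  by rewrite gtr0_norm ?divr_gt0// ltr_pdivrMr// ltr_pMr// ltr1n.
exists L => // j /andP[mj jl].
have jlm : (j - m.+1 < l - m)%N by lia.
have := congr1 (fun A : 'rV_(l - m) => A ord0 (Ordinal jlm)) LE.
by rewrite !mxE/= addnS -addSn subnKC.
Qed.

(** * Outer almost sure convergence of the values *)

Theorem theorem3 (R : realType)
    (d : measure_display) (Omega : measurableType d) (P : probability Omega R)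
    (k : nat) (lambda : {sigma_finite_measure set (k.-tuple R) -> \bar R})
    (D : set (k.-tuple R)) (g : k.-tuple R -> R)
    (Pg : probability (k.-tuple R) R) (X : nat -> {RV P >-> k.-tuple R})
    (l m : nat) (phi : nat -> k.-tuple R -> R) (mu : nat -> R)
    (F : set (k.-tuple R -> R)) :
  let Ls := likelihood_ratios D g F in
  let valP := moment_val l m phi mu (fun h => 'E_Pg[h])%E Ls in
  let valPn := fun (n : nat) (w : Omega) =>
    moment_val l m phi mu (empirical X n w) Ls in
  (* setting *)
  measurable D ->
  (forall x, D x -> 0 < g x) ->
  has_density lambda D g Pg ->
  iid X Pg ->
  (m <= l)%N ->
  (exists2 j : nat, (1 <= j <= l)%N & forall x, D x -> phi j x = \1_D x) ->
  (forall f, F f -> forall x, D x -> 0 <= f x) ->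
  (* (1) *)
  (forall L, Ls L -> forall j : nat, (j <= l)%N ->
     Pg.-integrable D (EFin \o (phi j \* L))) ->
  (* (2) *)
  convex_set Ls ->
  (* (3) *)
  (exists2 L0, Ls L0 &
     (forall j : nat, (1 <= j <= m)%N -> ('E_Pg[phi j \* L0] < (mu j)%:E)%E) /\
     (forall j : nat, (m < j <= l)%N -> ('E_Pg[phi j \* L0] = (mu j)%:E)%E)) ->
  interior [set eq_moments Pg l m phi L | L in Ls]
    (\row_(i < l - m) mu (m + i.+1)%N) ->
  (* (4) *)
  valP \is a fin_num ->
  (* (5) *)
  (forall j : nat, (j <= l)%N ->
     has_integrable_envelope Pg D [set phi j \* L | L in Ls] /\
     glivenko_cantelli X Pg [set phi j \* L | L in Ls]) ->
  outer_as_cvg P (fun n w => `|valPn n w - valP|%E) (cst (0 : \bar R)).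
Proof.
move=> Ls valP valPn mD g0 Pgg iidX ml massj F0 iL cL [L0 LL0 [L0le L0eq]] intmu
  vfin GC.
pose E := fun h => ('E_Pg[h])%E.
have Lout L x : Ls L -> ~ D x -> L x = 0 by exact: likelihood_ratios_out.
have iT j L : (j <= l)%N -> Ls L -> Pg.-integrable setT (EFin \o (phi j \* L)).
  move=> jl LL; apply: integrable_out mD _ (iL _ LL _ jl) => x nDx /=.
  by rewrite (Lout _ _ LL nDx) mulr0.
have finE j L : (j <= l)%N -> Ls L -> E (phi j \* L) \is a fin_num.
  by move=> jl LL; apply: expectation_fin_num; apply/Lfun1_integrable/iT.
have aE j : (j <= l)%N -> affine_on Ls (moment phi E j).
  by move=> jl; apply: affine_expectation => L; exact: iT.
have /choice[M EM] : forall j, exists M : R, (j <= l)%N ->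
    forall L, Ls L -> `|moment phi E j L| <= M.
  move=> j; have [jl|] := boolP (j <= l)%N; last by exists 0.
  have [envj _] := GC j jl.
  have [||M HM] := expectation_envelope mD _ _ envj.
  - by move=> _ x [L LL <-] nDx /=; rewrite (Lout _ _ LL nDx) mulr0.
  - by move=> _ [L LL <-]; exact: iT.
  - by exists M => _ L LL; apply: HM; exists L.
have [r r0 ball] := interior_orthants intmu.
have [kappa k0 Ec] : exists2 kappa, 0 < kappa &
    corners Ls l m (moment phi E) mu kappa.
  apply: (@slater_corners _ _ Ls l m _ mu M r L0) => //.
  - by move=> j L jl; exact: EM.
  - move=> j /[dup] jP /andP[_ /leq_trans/(_ ml) jl].
    by rewrite -lte_fin fineK ?finE// L0le.
  - by move=> j jP; rewrite /moment /E L0eq.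
pose c := 1 + 4 * (M 0%N + kappa) / (kappa / 2).
have c0 : 0 <= c.
  have M0 := le_trans (normr_ge0 _) (EM 0%N isT _ LL0).
  by rewrite addr_ge0// divr_ge0 ?mulr_ge0 ?addr_ge0 ?divr_ge0// ltW.
have /choice[S SP] : forall j, exists S : nat -> Omega -> \bar R, (j <= l)%N ->
    (forall n, min_measurable_majorant P (fun w => `|empirical_discrepancy X Pg
       [set (phi j \* L)%R | L in Ls] n w - 0|%E) (S n)) /\
    {ae P, forall w, S n w @[n --> \oo] --> (0 : \bar R)}.
  move=> j; have [jl|_] := boolP (j <= l)%N; last by exists (fun _ => cst 0%E).
  by have [_ [S HS]] := GC j jl; exists S.
have S_ge j n w L : (j <= l)%N -> Ls L ->
    (`|empirical X n w (phi j \* L)%R - E (phi j \* L)%R| <= S j n w)%E.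
  move=> jl LL; have [/(_ n)[_ /(_ w) + _] _] := SP j jl.
  rewrite sube0; apply: le_trans; apply: le_trans (lee_abs _).
  by apply: ereal_sup_ubound; exists (phi j \* L) => //; exists L.
have S0 j n w : (j <= l)%N -> (0 <= S j n w)%E.
  by move=> jl; apply: le_trans (S_ge j n w L0 jl LL0).
(* The term 1/(n+1) only keeps the tolerance positive, as [moment_val_dist]
   requires. *)
pose e n w := (\sum_(j < l.+1) S j n w + (n.+1%:R^-1)%:E)%E.
have me n : measurable_fun setT (e n).
  apply: emeasurable_funD; last exact: measurable_cst.
  by apply: emeasurable_sum => j; have [/(_ n)[]] := SP j (ltn_ord j).
(* [moment_val_dist] needs a tolerance of at most [kappa / 4]; elsewhere [+oo] keeps [U n] a
   measurable upper bound. *)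
pose U n w := if (e n w <= (kappa / 4)%:E)%E then (c%:E * e n w)%E else +oo%E.
have mU n : measurable_fun setT (U n).
  apply: measurable_fun_ifT; last exact: measurable_cst.
    by apply: measurable_fun_lee => //; exact: measurable_cst.
  exact: measurable_funeM.
have sum0 n w : (0 <= \sum_(j < l.+1) S j n w)%E.
  by apply: sume_ge0 => j _; exact: S0 (ltn_ord j).
have dist_le_U n w : (`|valPn n w - valP| <= U n w)%E.
  rewrite /U; case: ifPn => [ek|_]; last exact: leey.
  have e_gt0 : (0 < e n w)%E.
    apply: (@lt_le_trans _ _ (n.+1%:R^-1)%:E); first by rewrite lte_fin invr_gt0.
    by rewrite /e leeDr.
  have e_fin : e n w \is a fin_num.
    by rewrite gt0_fin_numE// (le_lt_trans ek)// ltry.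
  rewrite -(fineK e_fin) -EFinM.
  have fe0 : 0 < fine (e n w) by rewrite -lte_fin fineK.
  apply: moment_val_dist => //; rewrite ?(fineK e_fin)//.
  - by move=> j _; exact: affine_empirical.
  - exact: (EM 0%N).
  - by move: ek; rewrite -{1}(fineK e_fin) lee_fin; lra.
  - move=> j L jl LL; rewrite -lee_fin fineK// -abse_EFin EFinB.
    rewrite !fineK ?finE//; apply: le_trans (S_ge j n w L jl LL) _.
    have jl' : (j < l.+1)%N by [].
    (* The sum dominates each of its nonnegative terms, so one tolerance serves every [j]. *)
    rewrite /e (bigD1 (Ordinal jl'))//= -addeA leeDl// adde_ge0//.
    by apply: sume_ge0 => i _; exact: S0 (ltn_ord i).
have /choice[Z ZP] := fun n => ex_min_measurable_majorant P
  (fun w => `| `|valPn n w - valP| - 0|%E).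
exists Z; split => //.
(* Minimality transfers the bound [U n] to the majorant almost surely, and countably many null sets
   are discarded together. *)
have ZU : {ae P, forall w, forall n, (Z n w <= U n w)%E}.
  apply: ae_foralln => n; have [_ _ /(_ (U n) (mU n))] := ZP n.
  by apply; apply: aeW => w; rewrite sube0 abse_id dist_le_U.
have S_cvg : {ae P, forall w, forall j, (j <= l)%N ->
    S j n w @[n --> \oo] --> (0 : \bar R)}.
  apply: ae_foralln => j; have [jl|_] := boolP (j <= l)%N; last exact: aeW.
  by have [_] := SP j jl; apply: filterS.
move: ZU S_cvg; apply: filterS2 => w ZUw Sw.
have e_cvg : e n w @[n --> \oo] --> (0 : \bar R).
  rewrite -[X in _ --> X]adde0; apply: cvgeD => //.
    rewrite [X in _ --> X](_ : _ = \sum_(j < l.+1) (0 : \bar R))%E; last first.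
      by rewrite big1.
    apply: cvg_nnesum => j _; last exact: Sw (ltn_ord j).
    by apply: nearW => n; exact: S0 (ltn_ord j).
  apply: cvg_EFin; first exact: nearW.
  exact: cvg_harmonic.
(* Once [e n w] is below [kappa / 4], [U n w] is [c * e n w]. *)
have U_cvg : U n w @[n --> \oo] --> (0 : \bar R).
  have ce : (c%:E * e n w)%E @[n --> \oo] --> (0 : \bar R).
    by rewrite -[X in _ --> X](mule0 c%:E); exact: cvgeZl.
  apply: cvg_trans ce; apply: near_eq_cvg.
  have : \forall n \near \oo, (e n w < (kappa / 4)%:E)%E.
    have k4 : 0 < kappa / 4 by rewrite divr_gt0.
    exact: (e_cvg _ (@nbhs_open_ereal_lt _ 0 (fun=> kappa / 4) k4)).
  by apply: filterS => n /ltW ek; rewrite /U ek.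
apply: squeeze_cvge (cvg_cst 0%E) U_cvg; apply: nearW => n.
rewrite ZUw andbT; have [_ /(_ w) + _] := ZP n.
exact: le_trans.
Qed.
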